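(* Let $(f, I, U)$ be a safety verification problem that is robustly safe, such that the closures $\overline{I}$ and $\overline{U}$ are disjoint, and such that the set of safe states $\mathbb{R}^n\setminus U$ is bounded. Then $(f,I,U)$ has a barrier certificate.
   Context: A safety verification problem is a triple $(f,I,U)$ with $f:\mathbb{R}^n\to\mathbb{R}^n$ smooth, $I\subseteq\mathbb{R}^n$ (initial states) and $U\subseteq\mathbb{R}^n$ (unsafe states). Convention: the flow $\varphi_f(x,t)$ of $\dot x=f(x)$ (the state reached at time $t\in\mathbb{R}$ from $x$; negative $t$ allowed) is assumed defined for all $x\in\mathbb{R}^n$, $t\in\mathbb{R}$. For $\varepsilon\ge 0$, an $\varepsilon$-solution of $\dot x=f(x)$ is a differentiable function $x:\mathbb{R}^{\ge0}\to\mathbb{R}^n$ with $\|f(x(t))-\dot x(t)\|\le\varepsilon$ for all $t\ge0$ (Euclidean norm). For $X\subseteq\mathbb{R}^n$, $T\subseteq\mathbb{R}^{\ge 0}$: $R^{T}_{f,\varepsilon}(X)=\{x(t)\mid t\in T,\ x \text{ an } \varepsilon\text{-solution with } x(0)\in X\}$, and $R_{f,\varepsilon}(X)=R^{\mathbb{R}^{\ge0}}_{f,\varepsilon}(X)$. The problem $(f,I,U)$ is robustly safe iff there is $\varepsilon>0$ with $R_{f,\varepsilon}(I)\cap U=\emptyset$; such an $\varepsilon$ is called a robustness margin. A barrier certificate of $(f,I,U)$ is a differentiable $\beta:\mathbb{R}^n\to\mathbb{R}$ such that: (i) $x\in I\Rightarrow \beta(x)\ge 0$; (ii) $\beta(x)=0\Rightarrow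 (\nabla\beta(x))^T f(x)>0$; (iii) $\beta(x)\ge 0\Rightarrow x\notin U$. *)

(* Defs.v *)
From Stdlib Require Import Reals Lra Lia Arith.
Open Scope R_scope.

Definition Idx (n : nat) : Type := {i : nat | (i < n)%nat}.
Definition Vec (n : nat) : Type := Idx n -> R.

Definition get {n : nat} (x : Vec n) (i : nat) : R :=
  match lt_dec i n with
  | left h => x (exist _ i h)
  | right _ => 0
  end.

Definition vadd {n : nat} (x y : Vec n) : Vec n := fun i => x i + y i.
Definition vsub {n : nat} (x y : Vec n) : Vec n := fun i => x i - y i.
Definition vscale {n : nat} (a : R) (x : Vec n) : Vec n := fun i => a * x i.
Definition basis (n i : nat) : Vec n :=
  fun j => if Nat.eq_dec (proj1_sig j) i then 1 else 0.

Fixpoint nsum (k : nat) (h : nat -> R) : R :=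
  match k with
  | O => 0
  | S k' => nsum k' h + h k'
  end.

Definition dot {n : nat} (x y : Vec n) : R := nsum n (fun i => get x i * get y i).
Definition vnorm {n : nat} (x : Vec n) : R := sqrt (dot x x).

Definition vcontinuous {n : nat} (g : Vec n -> R) : Prop :=
  forall x eps, 0 < eps -> exists delta, 0 < delta /\
    forall y, vnorm (vsub y x) < delta -> Rabs (g y - g x) < eps.

Definition has_partial {n : nat} (g : Vec n -> R) (i : nat) (x : Vec n) (l : R) : Prop :=
  derivable_pt_lim (fun t => g (vadd x (vscale t (basis n i)))) 0 l.

Fixpoint Ck {n : nat} (k : nat) (g : Vec n -> R) : Prop :=
  match k with
  | O => vcontinuous g
  | S k' => vcontinuous g /\
      forall i, (i < n)%nat -> exists dg : Vec n -> R,
        (forall x, has_partial g i x (dg x)) /\ Ck k' dg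
  end.

Definition smooth {n : nat} (f : Vec n -> Vec n) : Prop :=
  forall (k j : nat), (j < n)%nat -> Ck k (fun x => get (f x) j).

Definition has_gradient {n : nat} (b : Vec n -> R) (x gr : Vec n) : Prop :=
  forall eps, 0 < eps -> exists delta, 0 < delta /\
    forall h : Vec n, vnorm h < delta ->
      Rabs (b (vadd x h) - b x - dot gr h) <= eps * vnorm h.

Definition differentiable {n : nat} (b : Vec n -> R) : Prop :=
  forall x, exists gr, has_gradient b x gr.

Definition has_vderiv_within (D : R -> Prop) {n : nat} (x : R -> Vec n) (t : R) (v : Vec n) : Prop :=
  forall eps, 0 < eps -> exists delta, 0 < delta /\
    forall s, D s -> Rabs (s - t) < delta ->
      vnorm (vsub (x s) (vadd (x t) (vscale (s - t) v))) <= eps * Rabs (s - t).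

Definition nonneg (t : R) : Prop := 0 <= t.
Definition allR (t : R) : Prop := True.

Definition flow_global {n : nat} (f : Vec n -> Vec n) : Prop :=
  forall x0 : Vec n, exists phi : R -> Vec n,
    phi 0 = x0 /\ forall t, has_vderiv_within allR phi t (f (phi t)).

(* eps-solution: a differentiable x : R^{>=0} -> R^n (values at negative times are irrelevant)
   with ||f(x(t)) - x'(t)|| <= eps for all t >= 0. *)
Definition eps_solution {n : nat} (f : Vec n -> Vec n) (eps : R) (x : R -> Vec n) : Prop :=
  exists xd : R -> Vec n, forall t, 0 <= t ->
    has_vderiv_within nonneg x t (xd t) /\ vnorm (vsub (f (x t)) (xd t)) <= eps.

Definition reach {n : nat} (f : Vec n -> Vec n) (eps : R) (X : Vec n -> Prop) (y : Vec n) : Prop :=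
  exists x : R -> Vec n, eps_solution f eps x /\ X (x 0) /\ exists t, 0 <= t /\ x t = y.

Definition robustly_safe {n : nat} (f : Vec n -> Vec n) (I U : Vec n -> Prop) : Prop :=
  exists eps, 0 < eps /\ forall y, reach f eps I y -> ~ U y.

Definition vclosure {n : nat} (A : Vec n -> Prop) (x : Vec n) : Prop :=
  forall eps, 0 < eps -> exists y, A y /\ vnorm (vsub x y) < eps.

Definition vbounded {n : nat} (A : Vec n -> Prop) : Prop :=
  exists M, forall x, A x -> vnorm x <= M.

Definition barrier_certificate {n : nat} (f : Vec n -> Vec n) (I U : Vec n -> Prop)
    (b : Vec n -> R) : Prop :=
  differentiable b /\
  (forall x, I x -> 0 <= b x) /\
  (forall x gr, b x = 0 -> has_gradient b x gr -> dot gr (f x) > 0) /\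
  (forall x, 0 <= b x -> ~ U x).

(* Main.v *)
From Stdlib Require Import Reals Lra Lia Arith.
From Stdlib Require Import Classical ClassicalEpsilon FunctionalExtensionality.
From Coquelicot Require Import Coquelicot.
Require Import Defs.
Open Scope R_scope.

(** Consider polygonal chains starting in [I] whose steps [y -> y + s v] satisfy
    [0 < s <= s0] and [|v - f y| <= eps/4], and let [P] be the set of their endpoints.
    Rounding the corners by cubic Hermite interpolation (with velocity [f] at the nodes)
    turns a chain with error [eps/2] into an eps-solution, so its endpoint is safe.  Tilting a
    chain that lasts for at least a fixed time by a small affine displacement moves its endpoint
    anywhere in a small ball; short chains stay near [I], which has positive distance from [U].
    Hence the [r]-neighbourhood of [P] is safe for some [r > 0].  As [P] is closed under chain
    steps, a point close to but outside [P] that moves with velocity [f] approaches [P] at a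
    positive rate, uniformly.  So [r/2 - dist(., P)] is a Lipschitz barrier whose increments
    along [f] are bounded below; averaging it over a small cube, one coordinate at a time,
    keeps these bounds and makes it differentiable. *)

(** * Euclidean vectors *)

Lemma get_exist {n : nat} (x : Vec n) (i : nat) (h : (i < n)%nat) :
  get x i = x (exist _ i h).
Proof.
  unfold get. destruct (lt_dec i n) as [h' | h']; [ | contradiction].
  f_equal. f_equal. apply le_unique.
Qed.

Lemma get_vadd {n : nat} (x y : Vec n) (i : nat) :
  get (vadd x y) i = get x i + get y i.
Proof. unfold get, vadd. destruct (lt_dec i n); ring. Qed.

Lemma get_vsub {n : nat} (x y : Vec n) (i : nat) :
  get (vsub x y) i = get x i - get y i.
Proof. unfold get, vsub. destruct (lt_dec i n); ring. Qed.

Lemma get_vscale {n : nat} (a : R) (x : Vec n) (i : nat) :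
  get (vscale a x) i = a * get x i.
Proof. unfold get, vscale. destruct (lt_dec i n); ring. Qed.

Lemma get_basis (n i j : nat) :
  (j < n)%nat -> get (basis n i) j = if Nat.eq_dec j i then 1 else 0.
Proof. intros h. now rewrite (get_exist _ _ h). Qed.

Lemma vec_ext {n : nat} (x y : Vec n) :
  (forall i, (i < n)%nat -> get x i = get y i) -> x = y.
Proof.
  intros H. apply functional_extensionality. intros [i h].
  now rewrite <- !get_exist, H.
Qed.

Ltac vec_ring :=
  apply functional_extensionality; intro;
  unfold vadd, vsub, vscale; (ring || (field; try lra)).

Lemma nsum_ext (k : nat) (u v : nat -> R) :
  (forall i, (i < k)%nat -> u i = v i) -> nsum k u = nsum k v.
Proof.
  induction k as [|k IH]; intros H; simpl; [reflexivity|].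
  rewrite IH, H; auto.
Qed.

Lemma nsum_le (k : nat) (u v : nat -> R) :
  (forall i, (i < k)%nat -> u i <= v i) -> nsum k u <= nsum k v.
Proof.
  induction k as [|k IH]; intros H; simpl; [lra|].
  apply Rplus_le_compat; auto.
Qed.

Lemma nsum_plus (k : nat) (u v : nat -> R) :
  nsum k (fun i => u i + v i) = nsum k u + nsum k v.
Proof. induction k as [|k IH]; simpl; [|rewrite IH]; ring. Qed.

Lemma nsum_scal (k : nat) (a : R) (u : nat -> R) :
  nsum k (fun i => a * u i) = a * nsum k u.
Proof. induction k as [|k IH]; simpl; [|rewrite IH]; ring. Qed.

Lemma nsum_const (k : nat) (a : R) : nsum k (fun _ => a) = INR k * a.
Proof. induction k as [|k IH]; [simpl; ring|]. rewrite S_INR; simpl; rewrite IH; ring. Qed.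

Lemma nsum_nonneg (k : nat) (u : nat -> R) :
  (forall i, (i < k)%nat -> 0 <= u i) -> 0 <= nsum k u.
Proof.
  intros H. replace 0 with (nsum k (fun _ => 0)) by (rewrite nsum_const; ring).
  now apply nsum_le.
Qed.

Lemma nsum_term_le (k : nat) (u : nat -> R) (i : nat) :
  (forall j, (j < k)%nat -> 0 <= u j) -> (i < k)%nat -> u i <= nsum k u.
Proof.
  induction k as [|k IH]; intros H Hi; [lia|]; simpl.
  destruct (Nat.eq_dec i k) as [->|].
  - assert (0 <= nsum k u) by (apply nsum_nonneg; auto). lra.
  - assert (u i <= nsum k u) by (apply IH; auto; lia).
    assert (0 <= u k) by auto. lra.
Qed.

Lemma dot_nonneg {n : nat} (x : Vec n) : 0 <= dot x x.
Proof. apply nsum_nonneg. intros; apply Rle_0_sqr. Qed.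

Lemma vnorm_nonneg {n : nat} (x : Vec n) : 0 <= vnorm x.
Proof. apply sqrt_pos. Qed.

Lemma vnorm_sq {n : nat} (x : Vec n) : vnorm x * vnorm x = dot x x.
Proof. apply sqrt_sqrt, dot_nonneg. Qed.

Lemma dot_vscale_r {n : nat} (a : R) (x y : Vec n) :
  dot x (vscale a y) = a * dot x y.
Proof.
  unfold dot. rewrite <- nsum_scal. apply nsum_ext. intros. rewrite get_vscale. ring.
Qed.

Lemma dot_sub_scale {n : nat} (a : R) (x y : Vec n) :
  dot (vsub x (vscale a y)) (vsub x (vscale a y))
  = dot x x + (- 2 * a) * dot x y + (a * a) * dot y y.
Proof.
  unfold dot. rewrite <- !nsum_scal, <- !nsum_plus. apply nsum_ext. intros.
  rewrite get_vsub, get_vscale. ring.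
Qed.

Lemma cauchy_schwarz {n : nat} (x y : Vec n) : Rabs (dot x y) <= vnorm x * vnorm y.
Proof.
  assert (H : dot x y * dot x y <= dot x x * dot y y).
  { assert (Hy := dot_nonneg y).
    destruct (Rle_lt_or_eq_dec _ _ Hy) as [Hp | Hz].
    (* The scale is that of the orthogonal projection of [x] onto [y], which minimises the
       quadratic. *)
    - assert (H := dot_nonneg (vsub x (vscale (dot x y / dot y y) y))).
      rewrite dot_sub_scale in H.
      apply (Rmult_le_compat_l (dot y y)) in H; [|lra].
      replace (dot y y * (dot x x + -2 * (dot x y / dot y y) * dot x y
                + dot x y / dot y y * (dot x y / dot y y) * dot y y))
        with (dot x x * dot y y - dot x y * dot x y) in H by (field; lra).
      lra.
    - rewrite <- Hz. destruct (Req_dec (dot x y) 0) as [H0 | H0]; [rewrite H0; lra|].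
      (* With [dot y y = 0] the expansion is affine in the scale, and this scale gives it the value
         -1. *)
      assert (H := dot_nonneg (vsub x (vscale ((dot x x + 1) / (2 * dot x y)) y))).
      rewrite dot_sub_scale, <- Hz in H.
      replace (-2 * ((dot x x + 1) / (2 * dot x y)) * dot x y)
        with (- (dot x x + 1)) in H by (field; exact H0).
      lra. }
  apply Rsqr_incr_0_var.
  - rewrite <- Rsqr_abs. unfold Rsqr.
    replace (vnorm x * vnorm y * (vnorm x * vnorm y))
      with ((vnorm x * vnorm x) * (vnorm y * vnorm y)) by ring.
    now rewrite !vnorm_sq.
  - apply Rmult_le_pos; apply vnorm_nonneg.
Qed.

Lemma vnorm_vadd {n : nat} (x y : Vec n) : vnorm (vadd x y) <= vnorm x + vnorm y.
Proof.
  assert (Hx := vnorm_nonneg x). assert (Hy := vnorm_nonneg y).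
  apply Rsqr_incr_0_var; [|lra]. unfold Rsqr.
  rewrite vnorm_sq.
  replace (vadd x y) with (vsub x (vscale (-1) y)) by vec_ring.
  rewrite dot_sub_scale.
  assert (H := cauchy_schwarz x y). assert (H' := Rle_abs (dot x y)).
  rewrite <- !vnorm_sq. nra.
Qed.

Lemma vnorm_vscale {n : nat} (a : R) (x : Vec n) : vnorm (vscale a x) = Rabs a * vnorm x.
Proof.
  unfold vnorm. rewrite <- sqrt_Rsqr_abs, <- sqrt_mult_alt by apply Rle_0_sqr.
  f_equal. unfold Rsqr, dot. rewrite <- nsum_scal. apply nsum_ext. intros.
  rewrite get_vscale. ring.
Qed.

Lemma vnorm_mono {n : nat} (x y : Vec n) :
  (forall i, (i < n)%nat -> Rabs (get x i) <= Rabs (get y i)) -> vnorm x <= vnorm y.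
Proof.
  intros H. apply sqrt_le_1_alt. apply nsum_le. intros i Hi.
  apply (Rsqr_le_abs_1 _ _ (H i Hi)).
Qed.

Lemma vnorm_vsub_sym {n : nat} (x y : Vec n) : vnorm (vsub x y) = vnorm (vsub y x).
Proof.
  replace (vsub x y) with (vscale (-1) (vsub y x)) by vec_ring.
  rewrite vnorm_vscale, (Rabs_left (-1)) by lra. ring.
Qed.

Lemma vnorm_vsub_triangle {n : nat} (x y z : Vec n) :
  vnorm (vsub x z) <= vnorm (vsub x y) + vnorm (vsub y z).
Proof.
  replace (vsub x z) with (vadd (vsub x y) (vsub y z)) by vec_ring. apply vnorm_vadd.
Qed.

Lemma vnorm_le_of_vsub {n : nat} (x y : Vec n) : vnorm x <= vnorm y + vnorm (vsub x y).
Proof.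
  replace x with (vadd y (vsub x y)) at 1 by vec_ring. apply vnorm_vadd.
Qed.

Lemma vsub_diag_norm {n : nat} (x : Vec n) : vnorm (vsub x x) = 0.
Proof.
  replace (vsub x x) with (vscale 0 x) by vec_ring.
  rewrite vnorm_vscale, Rabs_R0. ring.
Qed.

Lemma get_le_vnorm {n : nat} (x : Vec n) (i : nat) : Rabs (get x i) <= vnorm x.
Proof.
  destruct (lt_dec i n) as [h|h].
  - unfold vnorm. rewrite <- sqrt_Rsqr_abs. apply sqrt_le_1_alt.
    apply (nsum_term_le n (fun i => get x i * get x i)); auto. intros; apply Rle_0_sqr.
  - unfold get. destruct (lt_dec i n); [contradiction|]. rewrite Rabs_R0. apply vnorm_nonneg.
Qed.

Lemma vnorm_le_nsum {n : nat} (x : Vec n) : vnorm x <= nsum n (fun i => Rabs (get x i)).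
Proof.
  assert (H : forall k, 0 <= nsum k (fun i => Rabs (get x i)) /\
    nsum k (fun i => get x i * get x i) <= Rsqr (nsum k (fun i => Rabs (get x i)))).
  { induction k as [|k [IH1 IH2]]; simpl; [unfold Rsqr; lra|].
    assert (Hp := Rabs_pos (get x k)). split; [lra|].
    assert (Hs : get x k * get x k = Rabs (get x k) * Rabs (get x k)).
    { change (Rsqr (get x k) = Rsqr (Rabs (get x k))). apply Rsqr_abs. }
    unfold Rsqr in *. rewrite Hs. nra. }
  destruct (H n) as [H1 H2].
  apply sqrt_le_1_alt in H2. rewrite sqrt_Rsqr in H2 by exact H1. exact H2.
Qed.

Lemma vnorm_le_of_get {n : nat} (x : Vec n) (c : R) :
  (forall i, (i < n)%nat -> Rabs (get x i) <= c) -> vnorm x <= INR n * c.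
Proof.
  intros H. eapply Rle_trans; [apply vnorm_le_nsum|].
  rewrite <- nsum_const. now apply nsum_le.
Qed.

Lemma vnorm_basis (n i : nat) : vnorm (basis n i) <= 1.
Proof.
  rewrite <- sqrt_1. apply sqrt_le_1_alt. unfold dot.
  assert (H : forall k, (k <= n)%nat ->
    nsum k (fun j => get (basis n i) j * get (basis n i) j) <= if le_dec k i then 0 else 1).
  { induction k as [|k IH]; intros Hk; simpl; [destruct (le_dec 0 i); lra|].
    specialize (IH ltac:(lia)). rewrite get_basis by lia.
    destruct (Nat.eq_dec k i); destruct (le_dec k i); destruct (le_dec (S k) i);
      try lia; lra. }
  eapply Rle_trans; [apply H; lia|]. destruct (le_dec n i); lra.
Qed.

(** * Compactness of cubes *)

(** Nearest-point projection onto the cube of half-side [B]. Precomposing a field with it keeps the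
    field on the ball of radius [B] and makes it bounded and uniformly continuous everywhere. *)
Definition clamp {n : nat} (B : R) (x : Vec n) : Vec n :=
  fun i => Rmax (- B) (Rmin B (x i)).

Lemma get_clamp {n : nat} (B : R) (x : Vec n) (i : nat) :
  (i < n)%nat -> get (clamp B x) i = Rmax (- B) (Rmin B (get x i)).
Proof. intros h. now rewrite !(get_exist _ _ h). Qed.

Lemma clamp_bound {n : nat} (B : R) (x : Vec n) (i : nat) :
  0 <= B -> (i < n)%nat -> Rabs (get (clamp B x) i) <= B.
Proof.
  intros HB h. rewrite (get_clamp _ _ _ h). apply Rabs_le.
  unfold Rmax, Rmin. repeat destruct Rle_dec; lra.
Qed.

Lemma clamp_id {n : nat} (B : R) (x : Vec n) : vnorm x <= B -> clamp B x = x.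
Proof.
  intros H. apply vec_ext. intros i h. rewrite (get_clamp _ _ _ h).
  assert (Hi := Rle_trans _ _ _ (get_le_vnorm x i) H). apply Rabs_le_between in Hi.
  unfold Rmax, Rmin. repeat destruct Rle_dec; lra.
Qed.

Lemma clamp_lip {n : nat} (B : R) (x y : Vec n) :
  0 <= B -> vnorm (vsub (clamp B x) (clamp B y)) <= vnorm (vsub x y).
Proof.
  intros HB. apply vnorm_mono. intros i h.
  rewrite !get_vsub, !(get_clamp _ _ _ h).
  unfold Rmax, Rmin, Rabs. repeat destruct Rle_dec; repeat destruct Rcase_abs; lra.
Qed.

Fixpoint tuple_of (n : nat) (u : nat -> R) : Tn n R :=
  match n with
  | O => tt
  | S m => (u O, tuple_of m (fun i => u (S i)))
  end.

Fixpoint of_tuple (n : nat) : Tn n R -> nat -> R :=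
  match n with
  | O => fun _ _ => 0
  | S m => fun t i => match i with O => fst t | S j => of_tuple m (snd t) j end
  end.

Lemma tuple_of_bounded (n : nat) (u : nat -> R) (B : R) :
  (forall i, (i < n)%nat -> Rabs (u i) <= B) ->
  bounded_n n (tuple_of n (fun _ => - B)) (tuple_of n (fun _ => B)) (tuple_of n u).
Proof.
  revert u; induction n as [|n IH]; intros u H; simpl; [exact Logic.I|]. split.
  - apply Rabs_le_between, H. lia.
  - apply IH. intros; apply H; lia.
Qed.

Lemma close_n_tuple_of (n : nat) (d : R) (u : nat -> R) (t : Tn n R) :
  close_n n d (tuple_of n u) t ->
  forall i, (i < n)%nat -> Rabs (u i - of_tuple n t i) < d.
Proof.
  revert u t; induction n as [|n IH]; intros u t H i Hi; [lia|].
  destruct t as [t1 t2]. simpl in H. destruct H as [H1 H2].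
  destruct i as [|i]; simpl; [exact H1|].
  apply (IH (fun i => u (S i)) t2 H2). lia.
Qed.

(** One form of compactness for three uses: [Q y d] is a property at scale [d] that persists at
    smaller scales. Uniform continuity, boundedness and positive distance between sets are
    instances. *)
Lemma cube_compact {n : nat} (B : R) (Q : Vec n -> R -> Prop) :
  (forall y d d', Q y d -> 0 < d' <= d -> Q y d') ->
  (forall x, exists d, 0 < d /\ forall y, vnorm (vsub y x) < d -> Q y d) ->
  exists d, 0 < d /\
    forall y : Vec n, (forall i, (i < n)%nat -> Rabs (get y i) <= B) -> Q y d.
Proof.
  intros Hmono Hloc.
  set (V := fun t : Tn n R => (fun i => of_tuple n t (proj1_sig i)) : Vec n).
  (* Tuples are compared coordinatewise and [vnorm] is at most [n] times the largest coordinate, so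
     the radius is divided by [S n], which is positive also for [n = 0]. *)
  assert (Hd : forall t : Tn n R, {d : posreal |
    forall y, vnorm (vsub y (V t)) < INR (S n) * d -> Q y d}).
  { intros t. apply constructive_indefinite_description.
    destruct (Hloc (V t)) as [d [Hd H]].
    assert (Hn : 1 <= INR (S n)) by (rewrite S_INR; pose proof (pos_INR n); lra).
    assert (Hp : 0 < d / INR (S n)) by (apply Rdiv_lt_0_compat; lra).
    exists (mkposreal _ Hp). cbv beta iota delta [pos]. intros y Hy.
    replace (INR (S n) * (d / INR (S n))) with d in Hy by (field; lra).
    apply (Hmono y d); [apply H, Hy|]. split; [exact Hp|].
    apply Rle_div_l; [lra|]. rewrite <- (Rmult_1_r d) at 1.
    apply Rmult_le_compat_l; lra. }
  set (delta := fun t => proj1_sig (Hd t)).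
  destruct (compactness_value n (tuple_of n (fun _ => - B)) (tuple_of n (fun _ => B)) delta)
    as [d H].
  exists d. split; [apply cond_pos|]. intros y Hy.
  specialize (H (tuple_of n (get y)) (tuple_of_bounded _ _ _ Hy)).
  apply NNPP in H. destruct H as (t & _ & Hc & Hle).
  apply (Hmono y (delta t)); [|split; [apply cond_pos|exact Hle]].
  apply (proj2_sig (Hd t)). fold (delta t).
  assert (Hp := cond_pos (delta t)).
  apply Rle_lt_trans with (INR n * delta t).
  - apply vnorm_le_of_get. intros i Hi. rewrite get_vsub.
    apply Rlt_le. unfold V. rewrite (get_exist (fun i => of_tuple n t (proj1_sig i)) i Hi).
    simpl. now apply close_n_tuple_of.
  - rewrite S_INR. lra.
Qed.

(** * Continuous vector fields frozen outside a cube *)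

Lemma vec_continuous {n : nat} (f : Vec n -> Vec n) :
  (forall j, (j < n)%nat -> vcontinuous (fun x => get (f x) j)) ->
  forall x eps, 0 < eps -> exists d, 0 < d /\
    forall y, vnorm (vsub y x) < d -> vnorm (vsub (f y) (f x)) < eps.
Proof.
  intros Hf x eps Heps.
  assert (Hn := pos_INR n).
  assert (He : 0 < eps / (INR n + 1)) by (apply Rdiv_lt_0_compat; lra).
  assert (H : forall k, (k <= n)%nat -> exists d, 0 < d /\ forall y, vnorm (vsub y x) < d ->
    forall j, (j < k)%nat -> Rabs (get (f y) j - get (f x) j) < eps / (INR n + 1)).
  { induction k as [|k IH]; intros Hk.
    - exists 1. split; [lra|]. intros; lia.
    - destruct (IH ltac:(lia)) as (d1 & Hd1 & H1).
      destruct (Hf k ltac:(lia) x _ He) as (d2 & Hd2 & H2).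
      exists (Rmin d1 d2). split; [now apply Rmin_pos|]. intros y Hy j Hj.
      destruct (Nat.eq_dec j k) as [->|].
      + apply H2. eapply Rlt_le_trans; [exact Hy|apply Rmin_r].
      + apply H1; [|lia]. eapply Rlt_le_trans; [exact Hy|apply Rmin_l]. }
  destruct (H n (le_n n)) as (d & Hd & Hy). exists d. split; [exact Hd|].
  intros y Hyx. apply Rle_lt_trans with (INR n * (eps / (INR n + 1))).
  - apply vnorm_le_of_get. intros j Hj. rewrite get_vsub. apply Rlt_le. auto.
  - apply Rlt_le_trans with ((INR n + 1) * (eps / (INR n + 1))); [lra|].
    right. field. lra.
Qed.

Lemma clamp_uniformly_continuous {n : nat} (f : Vec n -> Vec n) (B w : R) :
  (forall j, (j < n)%nat -> vcontinuous (fun x => get (f x) j)) -> 0 <= B -> 0 < w ->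
  exists d, 0 < d /\ forall y z, vnorm (vsub z y) < d ->
    vnorm (vsub (f (clamp B z)) (f (clamp B y))) <= w.
Proof.
  intros Hf HB Hw.
  destruct (cube_compact B (fun y d => forall z, vnorm (vsub z y) < d ->
    vnorm (vsub (f z) (f y)) <= w)) as (d & Hd & H).
  - intros y d d' H Hd z Hz. apply H. lra.
  - intros x. destruct (vec_continuous f Hf x (w / 2) ltac:(lra)) as (d & Hd & H).
    exists (d / 2). split; [lra|]. intros y Hy z Hz.
    eapply Rle_trans; [apply (vnorm_vsub_triangle _ (f x))|].
    rewrite (vnorm_vsub_sym (f x)).
    assert (H1 := H y ltac:(lra)).
    assert (H2 := vnorm_vsub_triangle z y x).
    assert (H3 := H z ltac:(lra)). lra.
  - exists d. split; [exact Hd|]. intros y z Hz.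
    apply H; [intros; now apply clamp_bound|].
    eapply Rle_lt_trans; [now apply clamp_lip|exact Hz].
Qed.

Lemma clamp_bounded {n : nat} (f : Vec n -> Vec n) (B : R) :
  (forall j, (j < n)%nat -> vcontinuous (fun x => get (f x) j)) -> 0 <= B ->
  exists F, 0 <= F /\ forall y, vnorm (f (clamp B y)) <= F.
Proof.
  intros Hf HB.
  (* The bound is written [/ d] so that shrinking [d] weakens the property. *)
  destruct (cube_compact B (fun y d => vnorm (f y) <= / d)) as (d & Hd & H).
  - intros y d d' H Hd. eapply Rle_trans; [exact H|]. apply Rinv_le_contravar; lra.
  - intros x. destruct (vec_continuous f Hf x 1 ltac:(lra)) as (d & Hd & H).
    assert (Hx := vnorm_nonneg (f x)).
    assert (Hp : 0 < / (vnorm (f x) + 1)) by (apply Rinv_0_lt_compat; lra).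
    exists (Rmin d (/ (vnorm (f x) + 1))). split; [now apply Rmin_pos|].
    intros y Hy. apply Rle_trans with (vnorm (f x) + 1).
    + eapply Rle_trans; [apply (vnorm_le_of_vsub _ (f x))|].
      assert (h := H y (Rlt_le_trans _ _ _ Hy (Rmin_l _ _))). lra.
    + rewrite <- (Rinv_inv (vnorm (f x) + 1)) at 1.
      apply Rinv_le_contravar; [now apply Rmin_pos|apply Rmin_r].
  - exists (/ d). split; [now apply Rlt_le, Rinv_0_lt_compat|].
    intros y. apply H. intros; now apply clamp_bound.
Qed.

Lemma disjoint_closures_separated {n : nat} (X Y : Vec n -> Prop) :
  vbounded X -> (forall x, ~ (vclosure X x /\ vclosure Y x)) ->
  exists d, 0 < d /\ forall x y, X x -> Y y -> d <= vnorm (vsub y x).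
Proof.
  intros [M HM] Hdis.
  destruct (cube_compact M (fun x d => X x -> forall y, Y y -> d <= vnorm (vsub y x)))
    as (d & Hd & H).
  - intros x d d' H Hd Hx y Hy. specialize (H Hx y Hy). lra.
  (* Near a point outside the closure of [X] the property is vacuous; near a point at distance [e]
     from [Y] half of [e] survives. *)
  - intros x. destruct (not_and_or _ _ (Hdis x)) as [Hx | Hx];
      apply not_all_ex_not in Hx; destruct Hx as [e He];
      apply imply_to_and in He; destruct He as [He Hn].
    + exists e. split; [exact He|]. intros y Hy HX. exfalso. apply Hn.
      exists y. split; [exact HX|]. now rewrite vnorm_vsub_sym.
    + exists (e / 2). split; [lra|]. intros y Hy _ z Hz.
      apply Rnot_lt_le. intros Hlt. apply Hn. exists z. split; [exact Hz|].
      rewrite vnorm_vsub_sym. assert (h := vnorm_vsub_triangle z y x). lra.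
  - exists d. split; [exact Hd|]. intros x y Hx Hy. apply H; auto.
    intros i _. eapply Rle_trans; [apply get_le_vnorm|auto].
Qed.

(** * Smoothing by directional averages *)

Definition rlip (K : R) (u : R -> R) : Prop :=
  forall s t, Rabs (u s - u t) <= K * Rabs (s - t).

Lemma rlip_ex_RInt (K : R) (u : R -> R) (a b : R) : rlip K u -> ex_RInt u a b.
Proof.
  intros H. apply (ex_RInt_continuous (V := R_CompleteNormedModule)). intros z _.
  apply continuity_pt_filterlim. intros e He.
  assert (HK := Rabs_pos K).
  exists (e / (Rabs K + 1)). split; [apply Rdiv_lt_0_compat; lra|].
  intros y [_ Hy]. unfold R_met in *; simpl in *; unfold Rdist in *.
  apply Rle_lt_trans with ((Rabs K + 1) * Rabs (y - z)).
  - eapply Rle_trans; [apply H|]. apply Rmult_le_compat_r; [apply Rabs_pos|].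
    assert (h := Rle_abs K). lra.
  - replace e with ((Rabs K + 1) * (e / (Rabs K + 1))) by (field; lra).
    apply Rmult_lt_compat_l; lra.
Qed.

(** Between [a] and [a + t] the integrand differs from [u a] by at most [K] times the length of the
    interval. The error is quadratic in [t], as [c11_dir] demands; negative [t] is handled by
    reversing the orientation. *)
Lemma RInt_near_rectangle (K : R) (u : R -> R) (a t : R) :
  0 <= K -> rlip K u -> Rabs (RInt u a (a + t) - t * u a) <= K * (t * t).
Proof.
  intros HK Hu.
  assert (Hi : forall c d, ex_RInt (fun s => u s - u a) c d).
  { intros c d. apply (ex_RInt_minus u (fun _ => u a));
      [now apply (rlip_ex_RInt K)|apply ex_RInt_const]. }
  assert (E : RInt u a (a + t) - t * u a = RInt (fun s => u s - u a) a (a + t)).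
  { rewrite (RInt_minus u (fun _ => u a));
      [|now apply (rlip_ex_RInt K)|apply ex_RInt_const].
    rewrite RInt_const. unfold minus, plus, opp, scal; simpl; unfold mult; simpl. ring. }
  rewrite E. destruct (Rle_dec 0 t) as [Ht|Ht].
  - replace (K * (t * t)) with ((a + t - a) * (K * t)) by ring.
    apply abs_RInt_le_const; [lra|auto|]. intros s Hs.
    eapply Rle_trans; [apply Hu|]. apply Rmult_le_compat_l; [exact HK|].
    apply Rabs_le; lra.
  - rewrite <- opp_RInt_swap by auto.
    change (opp (RInt (fun s => u s - u a) (a + t) a))
      with (- (RInt (fun s => u s - u a) (a + t) a)).
    rewrite Rabs_Ropp.
    replace (K * (t * t)) with ((a - (a + t)) * (K * - t)) by ring.
    apply abs_RInt_le_const; [lra|auto|]. intros s Hs.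
    eapply Rle_trans; [apply Hu|]. apply Rmult_le_compat_l; [exact HK|].
    apply Rabs_le; lra.
Qed.

Definition avg (r : R) (u : R -> R) : R := RInt u 0 r / r.

Lemma avg_between (r K l m : R) (u : R -> R) :
  0 < r -> rlip K u -> (forall t, 0 <= t <= r -> l <= u t <= m) -> l <= avg r u <= m.
Proof.
  intros Hr Hu H. unfold avg.
  assert (Hi := rlip_ex_RInt K u 0 r Hu).
  assert (H1 : RInt (fun _ => l) 0 r <= RInt u 0 r).
  { apply RInt_le; [lra|apply ex_RInt_const|exact Hi|]. intros t Ht. apply H; lra. }
  assert (H2 : RInt u 0 r <= RInt (fun _ => m) 0 r).
  { apply RInt_le; [lra|exact Hi|apply ex_RInt_const|]. intros t Ht. apply H; lra. }
  rewrite RInt_const in H1, H2. unfold scal in *; simpl in *; unfold mult in *; simpl in *.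
  split; [apply Rle_div_r|apply Rle_div_l]; lra.
Qed.

Lemma rlip_comb (K L c : R) (u v : R -> R) :
  rlip K u -> rlip L v -> rlip (K + Rabs c * L) (fun t => u t + c * v t).
Proof.
  intros Hu Hv s t.
  replace (u s + c * v s - (u t + c * v t)) with ((u s - u t) + c * (v s - v t)) by ring.
  eapply Rle_trans; [apply Rabs_triang|]. rewrite Rabs_mult.
  specialize (Hu s t). specialize (Hv s t).
  apply (Rmult_le_compat_l _ _ _ (Rabs_pos c)) in Hv. lra.
Qed.

Lemma avg_comb (r K L c : R) (u v : R -> R) :
  0 < r -> rlip K u -> rlip L v ->
  avg r (fun t => u t + c * v t) = avg r u + c * avg r v.
Proof.
  intros Hr Hu Hv. unfold avg.
  assert (E : RInt (fun t => u t + c * v t) 0 r = RInt u 0 r + c * RInt v 0 r).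
  { assert (Iu := rlip_ex_RInt K u 0 r Hu). assert (Iv := rlip_ex_RInt L v 0 r Hv).
    etransitivity.
    - apply (RInt_plus u (fun t => scal c (v t))); [exact Iu|].
      now apply (ex_RInt_scal v).
    - exact (f_equal (Rplus (RInt u 0 r)) (RInt_scal v 0 r c Iv)). }
  rewrite E. field. lra.
Qed.

Definition vlip {n : nat} (K : R) (h : Vec n -> R) : Prop :=
  0 <= K /\ forall x y, Rabs (h x - h y) <= K * vnorm (vsub x y).

Definition move {n : nat} (x : Vec n) (i : nat) (t : R) : Vec n :=
  vadd x (vscale t (basis n i)).

Lemma move_dist {n : nat} (x : Vec n) (i : nat) (t : R) :
  vnorm (vsub (move x i t) x) <= Rabs t.
Proof.
  replace (vsub (move x i t) x) with (vscale t (basis n i)) by (unfold move; vec_ring).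
  rewrite vnorm_vscale. assert (h := vnorm_basis n i).
  apply (Rmult_le_compat_l _ _ _ (Rabs_pos t)) in h. lra.
Qed.

Lemma vlip_line {n : nat} (K : R) (h : Vec n -> R) (x : Vec n) (i : nat) :
  vlip K h -> rlip K (fun t => h (move x i t)).
Proof.
  intros [HK H] s t. eapply Rle_trans; [apply H|].
  apply Rmult_le_compat_l; [exact HK|].
  replace (vsub (move x i s) (move x i t)) with (vsub (move x i (s - t)) x)
    by (unfold move; vec_ring).
  apply move_dist.
Qed.

Definition smooth_dir {n : nat} (r : R) (i : nat) (h : Vec n -> R) : Vec n -> R :=
  fun x => avg r (fun t => h (move x i t)).

(* A quantitative form of differentiability in direction [i] which is visibly
   preserved by averaging along any other direction. *)
Definition c11_dir {n : nat} (i : nat) (h : Vec n -> R) : Prop :=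
  exists K g, vlip K g /\
    forall x t, Rabs (h (move x i t) - h x - t * g x) <= K * (t * t).

(** Averaging is linear and monotone, so bounds on a difference of values pass to the averages. Both
    the Lipschitz constant and the increments along the field are preserved this way. *)
Lemma smooth_dir_diff_between {n : nat} (r K l m : R) (i : nat) (h : Vec n -> R) (x y : Vec n) :
  0 < r -> vlip K h ->
  (forall t, 0 <= t <= r -> l <= h (move x i t) - h (move y i t) <= m) ->
  l <= smooth_dir r i h x - smooth_dir r i h y <= m.
Proof.
  intros Hr Hh H. unfold smooth_dir.
  assert (Hx := vlip_line K h x i Hh). assert (Hy := vlip_line K h y i Hh).
  replace (avg r (fun t => h (move x i t)) - avg r (fun t => h (move y i t)))
    with (avg r (fun t => h (move x i t)) + (-1) * avg r (fun t => h (move y i t))) by ring.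
  rewrite <- (avg_comb r K K) by auto.
  eapply avg_between; [exact Hr|now apply rlip_comb|].
  intros t Ht. specialize (H t Ht). simpl. lra.
Qed.

Lemma smooth_dir_lip {n : nat} (r K : R) (i : nat) (h : Vec n -> R) :
  0 < r -> vlip K h -> vlip K (smooth_dir r i h).
Proof.
  intros Hr Hh. split; [apply Hh|]. intros x y. apply Rabs_le.
  apply (smooth_dir_diff_between r K); auto. intros t _.
  apply Rabs_le_between. destruct Hh as [_ Hh]. eapply Rle_trans; [apply Hh|].
  right. f_equal. f_equal. unfold move; vec_ring.
Qed.

Lemma smooth_dir_near {n : nat} (r K : R) (i : nat) (h : Vec n -> R) (x : Vec n) :
  0 < r -> vlip K h -> Rabs (smooth_dir r i h x - h x) <= K * r.
Proof.
  intros Hr Hh. assert (h x - K * r <= smooth_dir r i h x <= h x + K * r).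
  { unfold smooth_dir. eapply avg_between; [exact Hr|now apply (vlip_line K)|].
    intros t Ht. destruct Hh as [HK Hh].
    assert (H := Hh (move x i t) x). assert (H' := move_dist x i t).
    rewrite (Rabs_pos_eq t) in H' by lra.
    assert (K * vnorm (vsub (move x i t) x) <= K * r) by (apply Rmult_le_compat_l; lra).
    assert (H2 : Rabs (h (move x i t) - h x) <= K * r) by lra.
    apply Rabs_le_between in H2. lra. }
  apply Rabs_le. lra.
Qed.

(** Moving [x] slides the window of integration, so the derivative is the difference of the end
    values over [r]; it inherits the Lipschitz constant [2 * K / r]. *)
Lemma smooth_dir_c11_self {n : nat} (r K : R) (i : nat) (h : Vec n -> R) :
  0 < r -> vlip K h -> c11_dir i (smooth_dir r i h).
Proof.
  intros Hr Hh. assert (HK : 0 <= K) by apply Hh.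
  exists (2 * K / r), (fun x => (h (move x i r) - h x) / r).
  assert (HKr : 0 <= 2 * K / r) by (apply Rdiv_le_0_compat; lra).
  split; [split; [exact HKr|]|].
  - intros x y.
    replace ((h (move x i r) - h x) / r - (h (move y i r) - h y) / r)
      with (((h (move x i r) - h (move y i r)) - (h x - h y)) * / r) by (field; lra).
    rewrite Rabs_mult, (Rabs_pos_eq (/ r)) by (apply Rlt_le, Rinv_0_lt_compat; lra).
    replace (2 * K / r * vnorm (vsub x y)) with (2 * K * vnorm (vsub x y) * / r)
      by (field; lra).
    apply Rmult_le_compat_r; [apply Rlt_le, Rinv_0_lt_compat; lra|].
    eapply Rle_trans; [apply Rabs_triang|]. rewrite Rabs_Ropp.
    destruct Hh as [_ Hh].
    assert (H1 := Hh x y). assert (H2 := Hh (move x i r) (move y i r)).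
    replace (vsub (move x i r) (move y i r)) with (vsub x y) in H2
      by (unfold move; vec_ring).
    lra.
  - intros x t.
    set (u := fun s => h (move x i s)).
    assert (Hu : rlip K u) by now apply vlip_line.
    assert (Hi := fun a b => rlip_ex_RInt K u a b Hu).
    assert (E : smooth_dir r i h (move x i t) = RInt u t (r + t) / r).
    { unfold smooth_dir, avg. f_equal.
      assert (Ec := RInt_comp_lin u 1 t 0 r (Hi _ _)).
      replace (1 * 0 + t) with t in Ec by ring.
      replace (1 * r + t) with (r + t) in Ec by ring.
      rewrite <- Ec.
      apply RInt_ext. intros s _. unfold scal; simpl; unfold mult; simpl.
      rewrite Rmult_1_l. unfold u. f_equal. unfold move. vec_ring. }
    assert (E0 : smooth_dir r i h x = RInt u 0 r / r) by reflexivity.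
    rewrite E, E0.
    (* The window shifted by [t] gains the strip from [r] to [r + t] and loses the strip from [0] to
       [t]; each is nearly a rectangle. *)
    assert (C1 := RInt_Chasles u 0 t (r + t) (Hi _ _) (Hi _ _)).
    assert (C2 := RInt_Chasles u 0 r (r + t) (Hi _ _) (Hi _ _)).
    unfold plus in C1, C2; simpl in C1, C2.
    assert (B1 := RInt_near_rectangle K u 0 t HK Hu).
    assert (B2 := RInt_near_rectangle K u r t HK Hu).
    rewrite Rplus_0_l in B1.
    replace (h x) with (u 0) by (unfold u; f_equal; unfold move; vec_ring).
    change (h (move x i r)) with (u r).
    replace (RInt u t (r + t) / r - RInt u 0 r / r - t * ((u r - u 0) / r))
      with (((RInt u r (r + t) - t * u r) - (RInt u 0 t - t * u 0)) * / r).
    2:{ assert (E2 : RInt u t (r + t) = RInt u 0 r + RInt u r (r + t) - RInt u 0 t) by lra.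
        rewrite E2. field. lra. }
    rewrite Rabs_mult, (Rabs_pos_eq (/ r)) by (apply Rlt_le, Rinv_0_lt_compat; lra).
    replace (2 * K / r * (t * t)) with (2 * K * (t * t) * / r) by (field; lra).
    apply Rmult_le_compat_r; [apply Rlt_le, Rinv_0_lt_compat; lra|].
    eapply Rle_trans; [apply Rabs_triang|]. rewrite Rabs_Ropp. lra.
Qed.

(** The inequality in [c11_dir] is linear in [h] and [g], and translations commute; averaging it
    along [j] gives the same inequality for the averages. *)
Lemma smooth_dir_c11_other {n : nat} (r L : R) (i j : nat) (h : Vec n -> R) :
  0 < r -> vlip L h -> c11_dir i h -> c11_dir i (smooth_dir r j h).
Proof.
  intros Hr Hh (K & g & Hg & H). exists K, (smooth_dir r j g).
  split; [now apply smooth_dir_lip|]. intros x t.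
  assert (H1 := vlip_line L h (move x i t) j Hh).
  assert (H2 := vlip_line L h x j Hh).
  assert (H3 := vlip_line K g x j Hg).
  unfold smooth_dir.
  replace (avg r (fun s => h (move (move x i t) j s)) - avg r (fun s => h (move x j s))
           - t * avg r (fun s => g (move x j s)))
    with ((avg r (fun s => h (move (move x i t) j s)) + (-1) * avg r (fun s => h (move x j s)))
           + (- t) * avg r (fun s => g (move x j s))) by ring.
  assert (H12 := rlip_comb _ _ (-1) _ _ H1 H2).
  rewrite <- (avg_comb _ _ _ _ _ _ Hr H1 H2), <- (avg_comb _ _ _ _ _ _ Hr H12 H3).
  apply Rabs_le. eapply avg_between; [exact Hr|apply (rlip_comb _ _ _ _ _ H12 H3)|].
  intros s _. simpl. apply Rabs_le_between.
  replace (h (move (move x i t) j s) + -1 * h (move x j s) + - t * g (move x j s))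
    with (h (move (move x j s) i t) - h (move x j s) - t * g (move x j s)).
  - apply H.
  - replace (move (move x j s) i t) with (move (move x i t) j s)
      by (unfold move; vec_ring). ring.
Qed.

Fixpoint smooth_dirs {n : nat} (r : R) (k : nat) (h : Vec n -> R) : Vec n -> R :=
  match k with
  | O => h
  | S k' => smooth_dir r k' (smooth_dirs r k' h)
  end.

Lemma smooth_dirs_lip {n : nat} (r K : R) (k : nat) (h : Vec n -> R) :
  0 < r -> vlip K h -> vlip K (smooth_dirs r k h).
Proof. intros Hr Hh. induction k; simpl; [exact Hh|]. now apply smooth_dir_lip. Qed.

Lemma smooth_dirs_near {n : nat} (r K : R) (k : nat) (h : Vec n -> R) (x : Vec n) :
  0 < r -> vlip K h -> Rabs (smooth_dirs r k h x - h x) <= INR k * (K * r).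
Proof.
  intros Hr Hh. induction k as [|k IH].
  - simpl. rewrite Rminus_diag, Rabs_R0. lra.
  - rewrite S_INR. simpl smooth_dirs.
    assert (H := smooth_dir_near r K k _ x Hr (smooth_dirs_lip r K k h Hr Hh)).
    replace (smooth_dir r k (smooth_dirs r k h) x - h x) with
      ((smooth_dir r k (smooth_dirs r k h) x - smooth_dirs r k h x)
        + (smooth_dirs r k h x - h x)) by ring.
    eapply Rle_trans; [apply Rabs_triang|]. lra.
Qed.

Lemma smooth_dirs_c11 {n : nat} (r K : R) (k : nat) (h : Vec n -> R) :
  0 < r -> vlip K h -> forall i, (i < k)%nat -> c11_dir i (smooth_dirs r k h).
Proof.
  intros Hr Hh. induction k as [|k IH]; intros i Hi; [lia|]. simpl.
  assert (Hs := smooth_dirs_lip r K k h Hr Hh).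
  destruct (Nat.eq_dec i k) as [->|].
  - now apply (smooth_dir_c11_self r K).
  - apply (smooth_dir_c11_other r K); auto. apply IH. lia.
Qed.

(** Each average only looks at points within [r], so every direction enlarges the radius on which
    the increment must be controlled by [r]. *)
Lemma smooth_dirs_increment {n : nat} (r K c e : R) (k : nat) (h : Vec n -> R) (x0 w : Vec n) :
  0 < r -> vlip K h ->
  (forall x, vnorm (vsub x x0) <= e + INR k * r -> c <= h (vadd x w) - h x) ->
  forall x, vnorm (vsub x x0) <= e -> c <= smooth_dirs r k h (vadd x w) - smooth_dirs r k h x.
Proof.
  intros Hr Hh. revert e. induction k as [|k IH]; intros e H x Hx.
  - apply H. simpl. lra.
  - simpl.
    assert (Hs := smooth_dirs_lip r K k h Hr Hh).
    (* The two-sided lemma also asks for an upper bound, which the Lipschitz constant supplies. *)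
    eapply (smooth_dir_diff_between r K c (K * vnorm w)); [exact Hr|exact Hs|].
    intros t Ht.
    replace (move (vadd x w) k t) with (vadd (move x k t) w) by (unfold move; vec_ring).
    split.
    + apply (IH (e + r)).
      * intros y Hy. apply H. rewrite S_INR. lra.
      * eapply Rle_trans; [apply (vnorm_vsub_triangle _ x)|].
        assert (h1 := move_dist x k t). rewrite (Rabs_pos_eq t) in h1 by lra. lra.
    + eapply Rle_trans; [apply Rle_abs|]. eapply Rle_trans; [apply Hs|].
      right. f_equal. f_equal. vec_ring.
Qed.

(** Going from [x] to [x + w] one coordinate at a time, the partial derivatives are met at
    intermediate points; being Lipschitz they differ from those at [x] by a multiple of [vnorm w],
    so the total error is quadratic. *)
Lemma c11_differentiable {n : nat} (h : Vec n -> R) :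
  (forall i, (i < n)%nat -> c11_dir i h) -> differentiable h.
Proof.
  intros Hc x.
  set (part := fun (k : nat) (w : Vec n) =>
    (fun i => if lt_dec (proj1_sig i) k then w i else 0) : Vec n).
  assert (Hpart : forall k w, vnorm (part k w) <= vnorm w).
  { intros k w. apply vnorm_mono. intros i Hi. rewrite !(get_exist _ _ Hi).
    unfold part; simpl. destruct (lt_dec i k); [lra|]. rewrite Rabs_R0. apply Rabs_pos. }
  assert (H : forall k, (k <= n)%nat -> exists C gr, 0 <= C /\ forall w : Vec n,
    Rabs (h (vadd x (part k w)) - h x - nsum k (fun i => gr i * get w i))
      <= C * (vnorm w * vnorm w)).
  { induction k as [|k IH]; intros Hk.
    - exists 0, (fun _ => 0). split; [lra|]. intros w. simpl.
      replace (vadd x (part 0%nat w)) with x.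
      + right. rewrite Rminus_0_r, Rminus_diag, Rabs_R0. ring.
      + apply functional_extensionality. intros i. unfold vadd, part.
        destruct (lt_dec (proj1_sig i) 0); [lia|ring].
    - destruct (IH ltac:(lia)) as (C & gr & HC & HB).
      destruct (Hc k ltac:(lia)) as (K & g & [HK Hg] & HE).
      (* One [K] pays for the expansion at [y], the other for replacing [g y] by [g x]. *)
      exists (C + 2 * K), (fun i => if Nat.eq_dec i k then g x else gr i).
      split; [lra|]. intros w. specialize (HB w).
      set (y := vadd x (part k w)) in *.
      assert (Ey : vadd x (part (S k) w) = move y k (get w k)).
      { apply vec_ext. intros i Hi. unfold move, y.
        rewrite !get_vadd, get_vscale, get_basis by exact Hi.
        rewrite !(get_exist (part _ w) _ Hi).
        unfold part; simpl. rewrite <- (get_exist w _ Hi).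
        destruct (lt_dec i (S k)), (lt_dec i k), (Nat.eq_dec i k); try lia; subst; ring. }
      rewrite Ey. specialize (HE y (get w k)). specialize (Hg y x).
      simpl nsum. destruct (Nat.eq_dec k k) as [_|]; [|lia].
      rewrite (nsum_ext k _ (fun i => gr i * get w i)).
      2:{ intros i Hi. destruct (Nat.eq_dec i k); [lia|reflexivity]. }
      assert (Hyx : vnorm (vsub y x) <= vnorm w).
      { replace (vsub y x) with (part k w) by (unfold y; vec_ring). apply Hpart. }
      assert (Hw := get_le_vnorm w k). assert (Hn := vnorm_nonneg w).
      assert (Hp := Rabs_pos (get w k)).
      assert (H1 : K * (get w k * get w k) <= K * (vnorm w * vnorm w)).
      { apply Rmult_le_compat_l; [exact HK|].
        replace (get w k * get w k) with (Rabs (get w k) * Rabs (get w k)).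
        - now apply Rmult_le_compat.
        - symmetry. apply Rsqr_abs. }
      assert (H2 : Rabs (get w k * (g y - g x)) <= K * (vnorm w * vnorm w)).
      { rewrite Rabs_mult. replace (K * (vnorm w * vnorm w)) with (vnorm w * (K * vnorm w)) by ring.
        apply Rmult_le_compat; auto using Rabs_pos.
        eapply Rle_trans; [exact Hg|]. now apply Rmult_le_compat_l. }
      replace (h (move y k (get w k)) - h x
               - (nsum k (fun i => gr i * get w i) + g x * get w k))
        with ((h (move y k (get w k)) - h y - get w k * g y)
              + (h y - h x - nsum k (fun i => gr i * get w i))
              + get w k * (g y - g x)) by ring.
      eapply Rle_trans; [apply Rabs_triang|].
      assert (H3 := Rabs_triang (h (move y k (get w k)) - h y - get w k * g y)
                  (h y - h x - nsum k (fun i => gr i * get w i))).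
      lra. }
  destruct (H n (le_n n)) as (C & gr & HC & HB).
  exists (fun i => gr (proj1_sig i)). intros eps Heps.
  exists (eps / (C + 1)). split; [apply Rdiv_lt_0_compat; lra|].
  intros w Hw. specialize (HB w).
  replace (part n w) with w in HB.
  2:{ apply functional_extensionality. intros [i Hi]. unfold part; simpl.
      destruct (lt_dec i n); [reflexivity|contradiction]. }
  unfold dot. rewrite (nsum_ext n _ (fun i => gr i * get w i)).
  2:{ intros i Hi. f_equal. now rewrite (get_exist _ _ Hi). }
  eapply Rle_trans; [exact HB|]. rewrite <- Rmult_assoc.
  assert (Hn := vnorm_nonneg w).
  apply Rmult_le_compat_r; [exact Hn|].
  apply Rle_trans with ((C + 1) * (eps / (C + 1))).
  - apply Rmult_le_compat; lra.
  - right. field. lra.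
Qed.

(** * Chains and eps-solutions *)

(** The condition of [eps_solution] at one time, with the velocity [d] explicit so that velocities
    can be matched when paths are glued. *)
Definition solves {n : nat} (f : Vec n -> Vec n) (eps : R) (x d : R -> Vec n) (t : R) : Prop :=
  has_vderiv_within nonneg x t (d t) /\ vnorm (vsub (f (x t)) (d t)) <= eps.

Definition glue {n : nat} (T : R) (x y : R -> Vec n) : R -> Vec n :=
  fun t => if Rle_dec t T then x t else y (t - T).

Lemma glue_l {n : nat} (T : R) (x y : R -> Vec n) (t : R) : t <= T -> glue T x y t = x t.
Proof. intros H. unfold glue. destruct (Rle_dec t T); [reflexivity|lra]. Qed.

Lemma glue_r {n : nat} (T : R) (x y : R -> Vec n) (t : R) :
  y 0 = x T -> T <= t -> glue T x y t = y (t - T).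
Proof.
  intros E H. unfold glue. destruct (Rle_dec t T); [|reflexivity].
  assert (t = T) by lra. subst. now rewrite Rminus_diag.
Qed.

(** At the junction, [x] gives the estimate from the left and [y], differentiable at 0 within
    nonnegative times, the one from the right; equal positions and velocities merge them into one
    derivative. *)
Lemma glue_solves {n : nat} (f : Vec n -> Vec n) (eps T : R) (x dx y dy : R -> Vec n) :
  0 <= T -> y 0 = x T -> dy 0 = dx T ->
  (forall t, 0 <= t <= T -> solves f eps x dx t) ->
  (forall t, 0 <= t -> solves f eps y dy t) ->
  forall t, 0 <= t -> solves f eps (glue T x y) (glue T dx dy) t.
Proof.
  intros HT E0 E1 Hx Hy t Ht.
  assert (Hl : t <= T -> forall e, 0 < e -> exists d, 0 < d /\ forall s, nonneg s -> s <= T ->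
    Rabs (s - t) < d -> vnorm (vsub (glue T x y s)
      (vadd (glue T x y t) (vscale (s - t) (glue T dx dy t)))) <= e * Rabs (s - t)).
  { intros Hle e He. destruct (proj1 (Hx t (conj Ht Hle)) e He) as (d & Hd & H).
    exists d. split; [exact Hd|]. intros s Hs HsT Hst. rewrite !glue_l by assumption. auto. }
  assert (Hr : T <= t -> forall e, 0 < e -> exists d, 0 < d /\ forall s, T <= s ->
    Rabs (s - t) < d -> vnorm (vsub (glue T x y s)
      (vadd (glue T x y t) (vscale (s - t) (glue T dx dy t)))) <= e * Rabs (s - t)).
  { intros Hle e He. destruct (proj1 (Hy (t - T) ltac:(lra)) e He) as (d & Hd & H).
    exists d. split; [exact Hd|]. intros s Hs Hst. rewrite !glue_r by assumption.
    replace (s - t) with (s - T - (t - T)) in * by ring. apply H; [unfold nonneg; lra|exact Hst]. }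
  split.
  - intros e He.
    destruct (Rtotal_order t T) as [Hlt | [-> | Hgt]].
    + destruct (Hl (Rlt_le _ _ Hlt) e He) as (d & Hd & H).
      exists (Rmin d (T - t)). split; [apply Rmin_pos; lra|]. intros s Hs Hst.
      assert (h1 := Rmin_l d (T - t)). assert (h2 := Rmin_r d (T - t)).
      assert (h3 := Rle_abs (s - t)).
      apply H; [exact Hs|lra|lra].
    + destruct (Hl (Rle_refl _) e He) as (d & Hd & H).
      destruct (Hr (Rle_refl _) e He) as (d' & Hd' & H').
      exists (Rmin d d'). split; [now apply Rmin_pos|]. intros s Hs Hst.
      assert (h1 := Rmin_l d d'). assert (h2 := Rmin_r d d').
      destruct (Rle_dec s T); [apply H; auto; lra|apply H'; lra].
    + destruct (Hr (Rlt_le _ _ Hgt) e He) as (d & Hd & H).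
      exists (Rmin d (t - T)). split; [apply Rmin_pos; lra|]. intros s Hs Hst.
      assert (h1 := Rmin_l d (t - T)). assert (h2 := Rmin_r d (t - T)).
      assert (h3 := Rcomplements.Rabs_maj2 (s - t)).
      apply H; lra.
  - destruct (Rle_dec t T).
    + rewrite !glue_l by assumption. now apply Hx.
    + rewrite !glue_r by (assumption || lra). apply Hy. lra.
Qed.

(** * Cubic Hermite arcs *)

Lemma vderiv_add_scale (D : R -> Prop) {n : nat} (x : R -> Vec n) (u : R -> R)
    (t l : R) (v w : Vec n) :
  has_vderiv_within D x t v -> derivable_pt_lim u t l ->
  has_vderiv_within D (fun s => vadd (x s) (vscale (u s) w)) t (vadd v (vscale l w)).
Proof.
  intros Hx Hu e He.
  assert (Hw := vnorm_nonneg w).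
  destruct (Hx (e / 2) ltac:(lra)) as (d1 & Hd1 & H1).
  assert (Hew : 0 < e / 2 / (vnorm w + 1)) by (apply Rdiv_lt_0_compat; lra).
  destruct (Hu _ Hew) as [d2 H2]. assert (Hd2 := cond_pos d2).
  exists (Rmin d1 d2). split; [now apply Rmin_pos|]. intros s Hs Hst.
  assert (h1 := Rmin_l d1 d2). assert (h2 := Rmin_r d1 d2).
  assert (Hr : Rabs (u s - u t - (s - t) * l) <= e / 2 / (vnorm w + 1) * Rabs (s - t)).
  { destruct (Req_dec s t) as [->|Hne].
    - replace (u t - u t - (t - t) * l) with 0 by ring. rewrite Rabs_R0.
      apply Rmult_le_pos; [lra|apply Rabs_pos].
    - specialize (H2 (s - t) ltac:(lra) ltac:(lra)).
      replace (t + (s - t)) with s in H2 by ring.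
      replace (u s - u t - (s - t) * l) with (((u s - u t) / (s - t) - l) * (s - t))
        by (field; lra).
      rewrite Rabs_mult. apply Rmult_le_compat_r; [apply Rabs_pos|lra]. }
  replace (vsub (vadd (x s) (vscale (u s) w))
             (vadd (vadd (x t) (vscale (u t) w)) (vscale (s - t) (vadd v (vscale l w)))))
    with (vadd (vsub (x s) (vadd (x t) (vscale (s - t) v)))
            (vscale (u s - u t - (s - t) * l) w)) by vec_ring.
  eapply Rle_trans; [apply vnorm_vadd|]. rewrite vnorm_vscale.
  specialize (H1 s Hs ltac:(lra)).
  assert (H3 : Rabs (u s - u t - (s - t) * l) * vnorm w <= e / 2 * Rabs (s - t)).
  { apply Rle_trans with (e / 2 / (vnorm w + 1) * Rabs (s - t) * (vnorm w + 1)).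
    - apply Rmult_le_compat; auto using Rabs_pos. lra.
    - right. field. lra. }
  lra.
Qed.

Lemma vderiv_const (D : R -> Prop) {n : nat} (p : Vec n) (t : R) :
  has_vderiv_within D (fun _ => p) t (vscale 0 p).
Proof.
  intros e He. exists 1. split; [lra|]. intros s _ _.
  replace (vsub p (vadd p (vscale (s - t) (vscale 0 p)))) with (vsub p p) by vec_ring.
  rewrite vsub_diag_norm. apply Rmult_le_pos; [lra|apply Rabs_pos].
Qed.

(* The cubic through [p] at time [0] and [p + s v] at time [s] with end velocities [a] and [b]. *)
Definition hermite {n : nat} (s : R) (p v a b : Vec n) (t : R) : Vec n :=
  vadd (vadd (vadd p (vscale (s * (3 * (t / s) ^ 2 - 2 * (t / s) ^ 3)) v))
             (vscale (s * ((t / s) - 2 * (t / s) ^ 2 + (t / s) ^ 3)) a))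
       (vscale (s * ((t / s) ^ 3 - (t / s) ^ 2)) b).

(** The time derivative of [hermite]: it equals [a] at time 0 and [b] at time [s]. *)
Definition hermite_vel {n : nat} (s : R) (v a b : Vec n) (t : R) : Vec n :=
  vadd (vadd (vscale (6 * (t / s) - 6 * (t / s) ^ 2) v)
             (vscale (1 - 4 * (t / s) + 3 * (t / s) ^ 2) a))
       (vscale (3 * (t / s) ^ 2 - 2 * (t / s)) b).

Lemma hermite_deriv (D : R -> Prop) {n : nat} (s : R) (p v a b : Vec n) (t : R) :
  0 < s -> has_vderiv_within D (hermite s p v a b) t (hermite_vel s v a b t).
Proof.
  intros Hs.
  replace (hermite_vel s v a b t) with
    (vadd (vadd (vadd (vscale 0 p) (vscale (6 * (t / s) - 6 * (t / s) ^ 2) v))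
             (vscale (1 - 4 * (t / s) + 3 * (t / s) ^ 2) a))
       (vscale (3 * (t / s) ^ 2 - 2 * (t / s)) b)) by (unfold hermite_vel; vec_ring).
  unfold hermite.
  repeat apply vderiv_add_scale; [apply vderiv_const| | |];
    apply is_derive_Reals; auto_derive; trivial; field; lra.
Qed.

Lemma hermite_close {n : nat} (s : R) (p v a b : Vec n) (t : R) :
  0 < s -> 0 <= t <= s ->
  vnorm (vsub (hermite s p v a b t) p) <= s * (vnorm v + vnorm a + vnorm b).
Proof.
  intros Hs Ht. unfold hermite.
  assert (Hu : 0 <= t / s <= 1).
  { split; [apply Rdiv_le_0_compat; lra|apply Rle_div_l; lra]. }
  set (u := t / s) in *.
  replace (vsub _ p) with
    (vadd (vadd (vscale (s * (3 * u ^ 2 - 2 * u ^ 3)) v)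
             (vscale (s * (u - 2 * u ^ 2 + u ^ 3)) a))
       (vscale (s * (u ^ 3 - u ^ 2)) b)) by vec_ring.
  assert (Hc : forall c w, Rabs c <= 1 -> @vnorm n (vscale (s * c) w) <= s * vnorm w).
  { intros c w Hc. rewrite vnorm_vscale, Rabs_mult, (Rabs_pos_eq s) by lra.
    assert (h := vnorm_nonneg w). apply Rmult_le_compat_r; [exact h|].
    rewrite <- (Rmult_1_r s) at 2. apply Rmult_le_compat_l; lra. }
  assert (P1 : 0 <= u * (1 - u)) by nra.
  assert (P2 : u * (1 - u) <= 1) by nra.
  eapply Rle_trans; [apply vnorm_vadd|].
  assert (h1 := vnorm_vadd (vscale (s * (3 * u ^ 2 - 2 * u ^ 3)) v)
             (vscale (s * (u - 2 * u ^ 2 + u ^ 3)) a)).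
  assert (h2 := Hc (3 * u ^ 2 - 2 * u ^ 3) v ltac:(apply Rabs_le; nra)).
  assert (h3 := Hc (u - 2 * u ^ 2 + u ^ 3) a ltac:(apply Rabs_le; nra)).
  assert (h4 := Hc (u ^ 3 - u ^ 2) b ltac:(apply Rabs_le; nra)).
  lra.
Qed.

(* The coefficients of the Hermite velocity sum to 1, so it deviates from [q] by a
   combination of the deviations of [v], [a] and [b]. *)
Lemma hermite_vel_close {n : nat} (s k l : R) (v a b q : Vec n) (t : R) :
  0 < s -> 0 <= t <= s ->
  vnorm (vsub q v) <= k -> vnorm (vsub q a) <= l -> vnorm (vsub q b) <= l ->
  vnorm (vsub q (hermite_vel s v a b t)) <= 3 / 2 * k + 2 * l.
Proof.
  intros Hs Ht Hv Ha Hb. unfold hermite_vel.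
  assert (Hu : 0 <= t / s <= 1).
  { split; [apply Rdiv_le_0_compat; lra|apply Rle_div_l; lra]. }
  set (u := t / s) in *.
  match goal with |- vnorm ?X <= _ => replace X with
    (vadd (vadd (vscale (6 * u - 6 * u ^ 2) (vsub q v))
             (vscale (1 - 4 * u + 3 * u ^ 2) (vsub q a)))
       (vscale (3 * u ^ 2 - 2 * u) (vsub q b))) by vec_ring end.
  assert (Hc : forall c m k' w, Rabs c <= m -> vnorm w <= k' ->
    @vnorm n (vscale c w) <= m * k').
  { intros c m k' w Hc Hw. rewrite vnorm_vscale.
    apply Rmult_le_compat; auto using Rabs_pos, vnorm_nonneg. }
  (* The squares vanish at the critical points of the three coefficients. The extrema there are 3/2,
     -1/3 and -1/3, whence the bounds 3/2, 1 and 1. *)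
  assert (P1 := pow2_ge_0 (1 - 2 * u)). assert (P2 := pow2_ge_0 (3 * u - 2)).
  assert (P3 := pow2_ge_0 (3 * u - 1)). assert (P4 : 0 <= u * (1 - u)) by nra.
  assert (h2 := Hc (6 * u - 6 * u ^ 2) (3 / 2) k _ ltac:(apply Rabs_le; nra) Hv).
  assert (h3 := Hc (1 - 4 * u + 3 * u ^ 2) 1 l _ ltac:(apply Rabs_le; nra) Ha).
  assert (h4 := Hc (3 * u ^ 2 - 2 * u) 1 l _ ltac:(apply Rabs_le; nra) Hb).
  eapply Rle_trans; [apply vnorm_vadd|].
  assert (h1 := vnorm_vadd (vscale (6 * u - 6 * u ^ 2) (vsub q v))
             (vscale (1 - 4 * u + 3 * u ^ 2) (vsub q a))).
  lra.
Qed.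

(** * Perturbed Euler polygons and their realisation by eps-solutions *)

Inductive chain {n : nat} (g : Vec n -> Vec n) (e s0 : R) (x : Vec n) : R -> Vec n -> Prop :=
  | chain_nil : chain g e s0 x 0 x
  | chain_step (T : R) (y : Vec n) (s : R) (v : Vec n) :
      chain g e s0 x T y -> 0 < s <= s0 -> vnorm (vsub v (g y)) <= e ->
      chain g e s0 x (T + s) (vadd y (vscale s v)).

Lemma chain_time_nonneg {n : nat} (g : Vec n -> Vec n) (e s0 T : R) (x y : Vec n) :
  chain g e s0 x T y -> 0 <= T.
Proof. induction 1; lra. Qed.

Lemma chain_dist {n : nat} (g : Vec n -> Vec n) (e s0 F T : R) (x y : Vec n) :
  (forall z, vnorm (g z) <= F) ->
  chain g e s0 x T y -> vnorm (vsub y x) <= T * (F + e).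
Proof.
  intros HF H. induction H as [|T y s v H IH Hs Hv].
  - rewrite vsub_diag_norm. lra.
  - replace (vsub (vadd y (vscale s v)) x) with (vadd (vsub y x) (vscale s v)) by vec_ring.
    eapply Rle_trans; [apply vnorm_vadd|].
    rewrite vnorm_vscale, (Rabs_pos_eq s) by lra.
    assert (h1 := vnorm_le_of_vsub v (g y)). assert (h2 := HF y).
    assert (h3 : s * vnorm v <= s * (F + e)) by (apply Rmult_le_compat_l; lra). lra.
Qed.

(** Adding [q] to every velocity displaces the vertex at time [T] by [T q]. The displacement stays
    below [d], so [g] at the vertex changes by at most [w], and the velocity error grows by at most
    [vnorm q + w]. *)
Lemma chain_shift {n : nat} (g : Vec n -> Vec n) (e e' s0 w d T0 T : R) (x y q : Vec n) :
  (forall y z, vnorm (vsub z y) < d -> vnorm (vsub (g z) (g y)) <= w) ->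
  T0 * vnorm q < d -> e + vnorm q + w <= e' ->
  chain g e s0 x T y -> T <= T0 -> chain g e' s0 x T (vadd y (vscale T q)).
Proof.
  intros Hg HT0 He H. induction H as [|T y s v H IH Hs Hv]; intros HT.
  - replace (vadd x (vscale 0 q)) with x by vec_ring. constructor.
  - assert (HTn := chain_time_nonneg _ _ _ _ _ _ H).
    replace (vadd (vadd y (vscale s v)) (vscale (T + s) q))
      with (vadd (vadd y (vscale T q)) (vscale s (vadd v q))) by vec_ring.
    constructor; [apply IH; lra|exact Hs|].
    set (y' := vadd y (vscale T q)).
    assert (Hy : vnorm (vsub (g y) (g y')) <= w).
    { apply Hg. rewrite vnorm_vsub_sym. unfold y'.
      replace (vsub (vadd y (vscale T q)) y) with (vscale T q) by vec_ring.
      rewrite vnorm_vscale, Rabs_pos_eq by exact HTn.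
      eapply Rle_lt_trans; [|exact HT0].
      apply Rmult_le_compat_r; [apply vnorm_nonneg|lra]. }
    replace (vsub (vadd v q) (g y'))
      with (vadd (vadd (vsub v (g y)) q) (vsub (g y) (g y'))) by vec_ring.
    eapply Rle_trans; [apply vnorm_vadd|].
    assert (h := vnorm_vadd (vsub v (g y)) q). lra.
Qed.

Lemma chain_reach {n : nat} (f g : Vec n -> Vec n) (X : Vec n -> Prop)
    (e eps w d s0 F M T : R) (x z : Vec n) :
  flow_global f ->
  (forall y, vnorm y <= M + 1 -> g y = f y) ->
  (forall y, vnorm (g y) <= F) ->
  (forall y z, vnorm (vsub z y) < d -> vnorm (vsub (g z) (g y)) <= w) ->
  0 <= F -> 0 <= e -> 0 <= eps -> 3 / 2 * (e + w) + 2 * w <= eps ->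
  s0 * (3 * F + e) < d / 2 -> s0 * (3 * F + e) <= 1 ->
  (forall y, reach f eps X y -> vnorm y <= M) ->
  X x -> chain g e s0 x T z -> reach f eps X z.
Proof.
  intros Hflow Hgf HF Hg HF0 He Heps Hew Hs1 Hs2 HM Hx Hch.
  (* An eps-solution lives for all nonnegative times, so every finite path is continued by the exact
     flow. *)
  assert (Hrest : forall p, exists y dy, y 0 = p /\ dy 0 = f p /\
    forall t, 0 <= t -> solves f eps y dy t).
  { intros p. destruct (Hflow p) as (phi & H0 & H). exists phi, (fun t => f (phi t)).
    split; [exact H0|]. split; [now rewrite H0|]. intros t _. split.
    - intros c Hc. destruct (H t c Hc) as (c' & Hc' & H'). exists c'. split; [exact Hc'|].
      intros s _ Hs. apply H'; [exact Logic.I|exact Hs].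
    - rewrite vsub_diag_norm. exact Heps. }
  assert (Hfin : forall p y dy T', 0 <= T' -> X (y 0) -> y T' = p ->
    (forall t, 0 <= t -> solves f eps y dy t) -> reach f eps X p).
  { intros p y dy T' HT' H0 HT'' H. exists y. split.
    - exists dy. intros t Ht. apply (H t Ht).
    - split; [exact H0|]. now exists T'. }
  (* The induction also records that the path arrives with velocity [f z], which lets the next arc
     be glued on differentiably. *)
  assert (Hmain : exists y dy T', 0 <= T' /\ X (y 0) /\ y T' = z /\ dy T' = f z /\
    forall t, 0 <= t -> solves f eps y dy t).
  { induction Hch as [|T p s v Hch IH Hs Hv].
    - destruct (Hrest x) as (y & dy & H0 & H1 & H). exists y, dy, 0.
      repeat split; try lra; try assumption; rewrite ?H0; try assumption; now apply H.
    - destruct IH as (y1 & dy1 & T1 & HT1 & HX & E1 & Ed1 & H1).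
      (* The vertex [p] is already reached, hence within [M]; the next arc has distance at most 1
         from it and so stays where [g] agrees with [f]. *)
      assert (HpM : vnorm p <= M) by (apply HM; eapply Hfin; eauto).
      set (b := vadd p (vscale s v)).
      assert (HvF : vnorm v <= F + e).
      { assert (h1 := vnorm_le_of_vsub v (g p)). assert (h2 := HF p). lra. }
      assert (Hsb : vnorm (vsub b p) <= s0 * (3 * F + e)).
      { unfold b. replace (vsub (vadd p (vscale s v)) p) with (vscale s v) by vec_ring.
        rewrite vnorm_vscale, Rabs_pos_eq by lra.
        apply Rmult_le_compat; try lra. apply vnorm_nonneg. }
      assert (Hgp : g p = f p) by (apply Hgf; lra).
      assert (Hgb : g b = f b).
      { apply Hgf. assert (h := vnorm_le_of_vsub b p). lra. }
      set (y2 := hermite s p v (g p) (g b)).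
      set (dy2 := hermite_vel s v (g p) (g b)).
      assert (H2 : forall t, 0 <= t <= s -> solves f eps y2 dy2 t).
      { intros t Ht. split; [apply hermite_deriv; lra|].
        (* The factor [3 * F + e] adds the bound [F + e] for [v] and [F] for each end velocity. *)
        assert (Hc : vnorm (vsub (y2 t) p) <= s0 * (3 * F + e)).
        { eapply Rle_trans; [apply hermite_close; [lra|exact Ht]|].
          assert (h1 := HF p). assert (h2 := HF b).
          apply Rmult_le_compat; try lra.
          assert (h3 := vnorm_nonneg v). assert (h4 := vnorm_nonneg (g p)).
          assert (h5 := vnorm_nonneg (g b)). lra. }
        assert (Ey : f (y2 t) = g (y2 t)).
        { symmetry. apply Hgf. assert (h := vnorm_le_of_vsub (y2 t) p). lra. }
        rewrite Ey.
        assert (hn := vnorm_nonneg (vsub (y2 t) p)).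
        assert (Hp2 : vnorm (vsub (g (y2 t)) (g p)) <= w) by (apply Hg; lra).
        assert (Hb2 : vnorm (vsub (g (y2 t)) (g b)) <= w).
        { apply Hg. eapply Rle_lt_trans; [apply (vnorm_vsub_triangle _ p)|].
          rewrite (vnorm_vsub_sym p b). lra. }
        eapply Rle_trans; [apply (hermite_vel_close s (e + w) w); auto; try lra|lra].
        eapply Rle_trans; [apply (vnorm_vsub_triangle _ (g p))|].
        rewrite (vnorm_vsub_sym (g p) v). lra. }
      assert (E20 : y2 0 = p).
      { unfold y2, hermite. replace (0 / s) with 0 by (field; lra). vec_ring. }
      assert (Ed20 : dy2 0 = f p).
      { unfold dy2, hermite_vel. replace (0 / s) with 0 by (field; lra).
        rewrite <- Hgp. vec_ring. }
      assert (E2s : y2 s = b).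
      { unfold y2, hermite. replace (s / s) with 1 by (field; lra). unfold b at 2. vec_ring. }
      assert (Ed2s : dy2 s = f b).
      { unfold dy2, hermite_vel. replace (s / s) with 1 by (field; lra).
        rewrite <- Hgb. vec_ring. }
      destruct (Hrest b) as (y3 & dy3 & E30 & Ed30 & H3).
      assert (H23 : forall t, 0 <= t -> solves f eps (glue s y2 y3) (glue s dy2 dy3) t).
      { apply glue_solves; auto; try lra; congruence. }
      assert (G0 : glue s y2 y3 0 = y1 T1) by (rewrite glue_l by lra; congruence).
      assert (Gd0 : glue s dy2 dy3 0 = dy1 T1) by (rewrite glue_l by lra; congruence).
      exists (glue T1 y1 (glue s y2 y3)), (glue T1 dy1 (glue s dy2 dy3)), (T1 + s).
      split; [lra|]. split; [rewrite glue_l by lra; exact HX|].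
      split.
      { rewrite glue_r by (assumption || lra). rewrite glue_l by lra.
        replace (T1 + s - T1) with s by ring. exact E2s. }
      split.
      { rewrite glue_r by (assumption || lra). rewrite glue_l by lra.
        replace (T1 + s - T1) with s by ring. exact Ed2s. }
      apply glue_solves; auto. intros t [Ht _]. now apply H1. }
  destruct Hmain as (y & dy & T' & HT' & HX & E & _ & H). eapply Hfin; eauto.
Qed.

(** * Distance to a forward closed set *)

(** The infimum need not be attained in [P], hence the second clause with slack [k]. It is obtained
    as minus the supremum of the negated distances. *)
Lemma distance_function {n : nat} (P : Vec n -> Prop) :
  (exists y, P y) -> exists p : Vec n -> R, forall x,
    (forall y, P y -> p x <= vnorm (vsub x y)) /\
    (forall k, 0 < k -> exists y, P y /\ vnorm (vsub x y) < p x + k).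
Proof.
  intros [y0 Hy0].
  assert (H : forall x, {d : R | (forall y, P y -> d <= vnorm (vsub x y)) /\
    (forall k, 0 < k -> exists y, P y /\ vnorm (vsub x y) < d + k)}).
  { intros x. apply constructive_indefinite_description.
    destruct (completeness (fun r => exists y, P y /\ r = - vnorm (vsub x y))) as [l [Hub Hl]].
    - exists 0. intros r (y & _ & ->). assert (h := vnorm_nonneg (vsub x y)). lra.
    - now exists (- vnorm (vsub x y0)), y0.
    - exists (- l). split.
      + intros y Hy. specialize (Hub _ (ex_intro _ y (conj Hy eq_refl))). lra.
      + intros k Hk. apply NNPP. intros Hn.
        assert (l <= l - k); [|lra]. apply Hl. intros r (y & Hy & ->).
        apply Rnot_lt_le. intros Hlt. apply Hn. exists y. split; [exact Hy|lra]. }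
  exists (fun x => proj1_sig (H x)). intros x. exact (proj2_sig (H x)).
Qed.

Lemma distance_lip {n : nat} (P : Vec n -> Prop) (p : Vec n -> R) :
  (forall x, (forall y, P y -> p x <= vnorm (vsub x y)) /\
    (forall k, 0 < k -> exists y, P y /\ vnorm (vsub x y) < p x + k)) ->
  forall x z, p x <= p z + vnorm (vsub x z).
Proof.
  intros Hp x z. apply le_epsilon. intros k Hk.
  destruct (proj2 (Hp z) k Hk) as (y & Hy & H).
  assert (h := proj1 (Hp x) y Hy). assert (h' := vnorm_vsub_triangle x z y). lra.
Qed.

(* The nearest point of [P] can be moved with velocity [v + c u], where [u] is the unit
   vector pointing to [x]; this gains [c s] over the motion of [x] itself. *)
Lemma distance_decreases {n : nat} (g : Vec n -> Vec n) (P : Vec n -> Prop) (p : Vec n -> R)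
    (e c s0 s l r : R) (x v : Vec n) :
  (forall x, (forall y, P y -> p x <= vnorm (vsub x y)) /\
    (forall k, 0 < k -> exists y, P y /\ vnorm (vsub x y) < p x + k)) ->
  (forall y s v, P y -> 0 < s <= s0 -> vnorm (vsub v (g y)) <= e -> P (vadd y (vscale s v))) ->
  0 < l -> l <= p x -> p x < r -> 0 < s <= s0 -> 0 <= c -> c * s <= l ->
  (forall y, vnorm (vsub x y) < r -> vnorm (vsub v (g y)) + c <= e) ->
  p (vadd x (vscale s v)) <= p x - c * s.
Proof.
  intros Hp HP Hl Hlx Hxr Hs Hc Hcs Hv. apply le_epsilon. intros k Hk.
  destruct (proj2 (Hp x) (Rmin k (r - p x))) as (y & Hy & H); [apply Rmin_pos; lra|].
  assert (h1 := Rmin_l k (r - p x)). assert (h2 := Rmin_r k (r - p x)).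
  assert (h3 := proj1 (Hp x) y Hy).
  set (D := vnorm (vsub x y)) in *.
  set (v' := vadd v (vscale (c / D) (vsub x y))).
  assert (Hy' : P (vadd y (vscale s v'))).
  { apply HP; auto.
    assert (Hvy : vnorm (vsub v (g y)) + c <= e) by (apply Hv; fold D; lra).
    replace (vsub v' (g y)) with (vadd (vsub v (g y)) (vscale (c / D) (vsub x y)))
      by (unfold v'; vec_ring).
    eapply Rle_trans; [apply vnorm_vadd|].
    rewrite vnorm_vscale. fold D. rewrite Rabs_pos_eq by (apply Rdiv_le_0_compat; lra).
    replace (c / D * D) with c by (field; lra). exact Hvy. }
  assert (h := proj1 (Hp (vadd x (vscale s v))) _ Hy').
  (* The difference vector merely shrinks by the factor [1 - c * s / D], nonnegative since
     [c * s <= l <= D]. *)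
  replace (vsub (vadd x (vscale s v)) (vadd y (vscale s v')))
    with (vscale (1 - c * s / D) (vsub x y)) in h by (unfold v'; vec_ring).
  rewrite vnorm_vscale in h. fold D in h.
  assert (c * s / D <= 1) by (apply Rle_div_l; lra).
  rewrite Rabs_pos_eq in h by lra.
  replace ((1 - c * s / D) * D) with (D - c * s) in h by (field; lra).
  lra.
Qed.

(** * The barrier as a smoothed distance *)

Lemma gradient_pos {n : nat} (b : Vec n -> R) (x v gr : Vec n) (c s1 : R) :
  0 < c -> 0 < s1 ->
  (forall s, 0 < s <= s1 -> c * s <= b (vadd x (vscale s v)) - b x) ->
  has_gradient b x gr -> dot gr v > 0.
Proof.
  intros Hc Hs1 Hinc Hgr.
  assert (Hv := vnorm_nonneg v).
  (* With this tolerance the linearisation error along [v] consumes at most half of the gain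
     [c * s]. *)
  assert (He : 0 < c / (2 * (vnorm v + 1))) by (apply Rdiv_lt_0_compat; lra).
  destruct (Hgr _ He) as (d & Hd & H).
  assert (Hq : 0 < d / (2 * (vnorm v + 1))) by (apply Rdiv_lt_0_compat; lra).
  set (s := Rmin s1 (d / (2 * (vnorm v + 1)))).
  assert (Hs : 0 < s) by now apply Rmin_pos.
  assert (h1 : s <= s1) by apply Rmin_l.
  assert (h2 : s <= d / (2 * (vnorm v + 1))) by apply Rmin_r.
  assert (Hsv : vnorm (vscale s v) = s * vnorm v) by (rewrite vnorm_vscale, Rabs_pos_eq; lra).
  assert (Hsd : s * (vnorm v + 1) <= d / 2).
  { apply Rle_trans with (d / (2 * (vnorm v + 1)) * (vnorm v + 1)).
    - apply Rmult_le_compat_r; lra.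
    - right. field. lra. }
  specialize (H (vscale s v) ltac:(rewrite Hsv; lra)).
  rewrite Hsv, dot_vscale_r in H. apply Rabs_le_between in H.
  specialize (Hinc s (conj Hs h1)).
  assert (Hes : c / (2 * (vnorm v + 1)) * (s * vnorm v) <= c * s / 2).
  { replace (c * s / 2) with (c / (2 * (vnorm v + 1)) * (s * (vnorm v + 1))) by (field; lra).
    apply Rmult_le_compat_l; [lra|]. apply Rmult_le_compat_l; lra. }
  assert (Hcs : 0 < c * s) by now apply Rmult_lt_0_compat.
  apply Rlt_gt, (Rmult_lt_reg_l s); [exact Hs|]. lra.
Qed.

(** Smoothing changes [r/2 - p] by at most [r/8]. So on [P] the barrier is at least [3r/8], where it
    is nonnegative [p] is at most [5r/8], and on its zero set [p] lies between [3r/8] and [5r/8]. *)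
Lemma barrier_of_forward_closed {n : nat} (f g : Vec n -> Vec n) (I U P : Vec n -> Prop)
    (e w d s0 M r : R) :
  (forall y, vnorm y <= M + 1 -> g y = f y) ->
  (forall y z, vnorm (vsub z y) < d -> vnorm (vsub (g z) (g y)) <= w) ->
  (forall y s v, P y -> 0 < s <= s0 -> vnorm (vsub v (g y)) <= e -> P (vadd y (vscale s v))) ->
  (forall y, P y -> vnorm y <= M) ->
  (forall y z, P y -> vnorm (vsub z y) < r -> ~ U z) ->
  (forall x, I x -> P x) -> (exists y, P y) ->
  0 < s0 -> 0 < r <= 1 -> 2 * r <= d -> 0 <= w < e ->
  exists b, barrier_certificate f I U b.
Proof.
  intros Hgf Hg HP HPM HPU HIP HPne Hs0 Hr Hrd Hwe.
  destruct (distance_function P HPne) as [p Hp].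
  assert (Hlip := distance_lip P p Hp).
  assert (Hn := pos_INR n).
  set (h := fun x => r / 2 - p x).
  assert (Hh : vlip 1 h).
  { split; [lra|]. intros x y. unfold h. apply Rabs_le.
    assert (h1 := Hlip x y). assert (h2 := Hlip y x).
    rewrite vnorm_vsub_sym in h2. lra. }
  set (rho := r / (8 * (INR n + 1))).
  assert (Hrho : 0 < rho) by (apply Rdiv_lt_0_compat; lra).
  assert (Hnr : INR n * rho <= r / 8).
  { apply Rle_trans with ((INR n + 1) * rho); [lra|]. right. unfold rho. field. lra. }
  set (b := smooth_dirs rho n h).
  assert (Hb : forall x, r / 2 - p x - r / 8 <= b x <= r / 2 - p x + r / 8).
  { intros x. assert (H := smooth_dirs_near rho 1 n h x Hrho Hh).
    fold b in H. apply Rabs_le_between in H. change (h x) with (r / 2 - p x) in H. lra. }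
  exists b. split; [|split; [|split]].
  - apply c11_differentiable. intros i Hi. now apply (smooth_dirs_c11 rho 1).
  - intros x Hx. specialize (Hb x). assert (H := proj1 (Hp x) x (HIP x Hx)).
    rewrite vsub_diag_norm in H. lra.
  - intros x0 gr Hb0 Hgr.
    assert (Hx0 := Hb x0). rewrite Hb0 in Hx0.
    assert (Hgx : g x0 = f x0).
    { apply Hgf. destruct (proj2 (Hp x0) (r / 8) ltac:(lra)) as (y & Hy & H).
      assert (h1 := HPM y Hy). assert (h2 := vnorm_le_of_vsub x0 y). lra. }
    set (c := e - w). assert (Hc : 0 < c) by (unfold c; lra).
    assert (Hcr : 0 < r / 4 / c) by (apply Rdiv_lt_0_compat; lra).
    apply (gradient_pos b x0 (f x0) gr c (Rmin s0 (r / 4 / c))); auto using Rmin_pos.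
    intros s Hs. assert (h1 := Rmin_l s0 (r / 4 / c)). assert (h2 := Rmin_r s0 (r / 4 / c)).
    apply (smooth_dirs_increment rho 1 (c * s) 0 n h x0); [exact Hrho|exact Hh| |].
    2:{ rewrite vsub_diag_norm. lra. }
    (* The cube averaged over has radius at most [r/8], so [p x] lies between [r/4] and [3r/4], as
       [distance_decreases] requires with [l = r/4]. *)
    intros x Hx.
    assert (l1 := Hlip x x0). assert (l2 := Hlip x0 x). rewrite vnorm_vsub_sym in l2.
    assert (Hinc : p (vadd x (vscale s (f x0))) <= p x - c * s).
    { apply (distance_decreases g P p e c s0 s (r / 4) r); auto; try lra.
      - rewrite Rmult_comm. apply Rle_div_r; lra.
      - intros y Hy. rewrite <- Hgx.
        assert (H : vnorm (vsub (g x0) (g y)) <= w); [|unfold c; lra].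
        (* A point [y] within [r] of [x] is within [r + r/8 < 2 * r <= d] of [x0], so the constant
           velocity [f x0] is [w]-close to [g y] and leaves the margin [c = e - w]. *)
        apply Hg. assert (h3 := vnorm_vsub_triangle x0 x y).
        rewrite (vnorm_vsub_sym x0 x) in h3. lra. }
    unfold h. lra.
  - intros x Hbx HU. specialize (Hb x).
    destruct (proj2 (Hp x) (r / 8) ltac:(lra)) as (y & Hy & H).
    apply (HPU y x Hy); [lra|exact HU].
Qed.

(** * From a robustness margin to a forward closed set with a safe neighbourhood *)

Theorem theorem1 (n : nat) (f : Vec n -> Vec n) (I U : Vec n -> Prop) :
  smooth f ->
  flow_global f ->
  robustly_safe f I U ->
  (forall x : Vec n, ~ (vclosure I x /\ vclosure U x)) ->
  vbounded (fun x : Vec n => ~ U x) ->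
  exists b : Vec n -> R, barrier_certificate f I U b.
Proof.
  intros Hf Hflow (eps & Heps & Hsafe) Hdis [M0 HM0].
  destruct (classic (exists x, I x)) as [[x0 Hx0] | HI].
  (* Without initial states a negative constant serves. *)
  2:{ exists (fun _ => -1). split; [|split; [|split]].
      - intros x. exists (vscale 0 x). intros c Hc. exists 1. split; [lra|]. intros h _.
        replace (dot (vscale 0 x) h) with 0.
        + replace (-1 - -1 - 0) with 0 by ring. rewrite Rabs_R0.
          apply Rmult_le_pos; [lra|apply vnorm_nonneg].
        + unfold dot. transitivity (nsum n (fun _ => 0)); [rewrite nsum_const; ring|].
          apply nsum_ext. intros. rewrite get_vscale. ring.
      - intros x Hx. exfalso. eauto.
      - intros; lra.
      - intros; lra. }
  set (M := Rmax M0 0).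
  assert (HM : 0 <= M) by apply Rmax_r.
  assert (HUM : forall y, ~ U y -> vnorm y <= M).
  { intros y Hy. eapply Rle_trans; [now apply HM0|apply Rmax_l]. }
  assert (Hreach : forall y, reach f eps I y -> vnorm y <= M) by auto.
  assert (Hcl : forall (A : Vec n -> Prop) x, A x -> vclosure A x).
  { intros A x Hx k Hk. exists x. split; [exact Hx|]. now rewrite vsub_diag_norm. }
  destruct (disjoint_closures_separated I U) as (d0 & Hd0 & Hsep); [|exact Hdis|].
  (* Disjoint closures put [I] inside the bounded safe set. *)
  { exists M. intros x Hx. apply HUM. intros HU. apply (Hdis x). auto. }
  assert (Hcont : forall j, (j < n)%nat -> vcontinuous (fun x => get (f x) j)).
  { intros j Hj. exact (Hf 0%nat j Hj). }
  set (g := fun x => f (clamp (M + 1) x)).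
  assert (Hgf : forall y, vnorm y <= M + 1 -> g y = f y).
  { intros y Hy. unfold g. now rewrite clamp_id. }
  destruct (clamp_bounded f (M + 1) Hcont ltac:(lra)) as (F & HF0 & HF).
  destruct (clamp_uniformly_continuous f (M + 1) (eps / 16) Hcont ltac:(lra) ltac:(lra))
    as (d & Hd & Hg).
  change (forall y, vnorm (g y) <= F) in HF.
  change (forall y z, vnorm (vsub z y) < d -> vnorm (vsub (g z) (g y)) <= eps / 16) in Hg.
  assert (Hs : exists s0, 0 < s0 /\ s0 * (3 * F + eps) < d / 2 /\ s0 * (3 * F + eps) <= 1).
  { assert (Hm : 0 < Rmin (d / 4) 1) by (apply Rmin_pos; lra).
    assert (h1 := Rmin_l (d / 4) 1). assert (h2 := Rmin_r (d / 4) 1).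
    exists (Rmin (d / 4) 1 / (3 * F + eps)). split; [apply Rdiv_lt_0_compat; lra|].
    replace (Rmin (d / 4) 1 / (3 * F + eps) * (3 * F + eps)) with (Rmin (d / 4) 1)
      by (field; lra). lra. }
  destruct Hs as (s0 & Hs0 & Hs1 & Hs2).
  (* Error budget with modulus [w = eps/16]: tilting needs [eps/4 + eps/16 + eps/16 <= eps/2], and
     rounding then needs [3/2 * (eps/2 + eps/16) + 2 * eps/16 = 31/32 * eps]. *)
  set (e := eps / 4).
  (* Speeds are at most [F + e], so a chain shorter than [th] stays within [d0/2] of its start. *)
  set (th := d0 / 2 / (F + e)).
  assert (Hth : 0 < th) by (apply Rdiv_lt_0_compat; unfold e; lra).
  assert (HthF : th * (F + e) = d0 / 2) by (unfold th, e; field; lra).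
  assert (Hr : exists r, 0 < r <= 1 /\ 2 * r <= d /\ r <= d0 / 2 /\ r <= eps / 16 * th).
  { assert (Ht : 0 < eps / 16 * th) by (apply Rmult_lt_0_compat; lra).
    exists (Rmin (Rmin 1 (d / 2)) (Rmin (d0 / 2) (eps / 16 * th))).
    unfold Rmin. repeat destruct Rle_dec; lra. }
  destruct Hr as (r & Hr & Hrd & Hr0 & Hrt).
  set (P := fun y => exists x T, I x /\ chain g e s0 x T y).
  assert (HPU : forall y z, P y -> vnorm (vsub z y) < r -> ~ U z).
  { intros y z (x & T & Hx & Hch) Hz HU.
    destruct (Rle_lt_dec th T) as [HT | HT].
    (* This tilt carries the endpoint from [y] exactly to [z]; as [T >= th], its size is at most
       [r / th <= eps/16]. *)
    - set (q := vscale (/ T) (vsub z y)).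
      assert (HT' : 0 < T) by lra.
      assert (Hq : vnorm q = vnorm (vsub z y) / T).
      { unfold q. rewrite vnorm_vscale, Rabs_pos_eq by (apply Rlt_le, Rinv_0_lt_compat; lra).
        field. lra. }
      assert (HTq : T * vnorm q = vnorm (vsub z y)) by (rewrite Hq; field; lra).
      assert (Hq' : vnorm q <= eps / 16).
      { rewrite Hq. apply Rle_div_l; [lra|].
        assert (eps / 16 * th <= eps / 16 * T) by (apply Rmult_le_compat_l; lra). lra. }
      assert (Hch' : chain g (eps / 2) s0 x T (vadd y (vscale T q))).
      { apply (chain_shift g e (eps / 2) s0 (eps / 16) d T); auto; unfold e; lra. }
      replace (vadd y (vscale T q)) with z in Hch' by (unfold q; vec_ring).
      apply (Hsafe z); [|exact HU].
      assert (s0 * (3 * F + eps / 2) <= s0 * (3 * F + eps)) by (apply Rmult_le_compat_l; lra).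
      apply (chain_reach f g I (eps / 2) eps (eps / 16) d s0 F M T x z); auto; lra.
    (* A short chain and the offset [r <= d0/2] together cover less than [d0], too little to reach
       [U] from [I]. *)
    - assert (h1 := Hsep x z Hx HU).
      assert (h2 := chain_dist g e s0 F T x y HF Hch).
      assert (h3 := vnorm_vsub_triangle z y x).
      assert (T * (F + e) < th * (F + e)) by (apply Rmult_lt_compat_r; unfold e; lra).
      lra. }
  apply (barrier_of_forward_closed f g I U P e (eps / 16) d s0 M r);
    auto; try (unfold e; lra).
  - intros y s v (x & T & Hx & Hch) Hs Hv. exists x, (T + s). split; [exact Hx|].
    now constructor.
  - intros y Hy. apply HUM. apply (HPU y y Hy). rewrite vsub_diag_norm. lra.
  - intros x Hx. exists x, 0. split; [exact Hx|constructor].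
  - exists x0, x0, 0. split; [exact Hx0|constructor].
Qed.
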